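(* Let $K\ge 2$ be the number of classes, let $\alpha<0$ be the smooth rate, and let $\gamma_1,\gamma_2>0$ be the weights of the learning and unlearning phases. Suppose $$\gamma_1-\gamma_2\Big(1+\frac{1-K}{K}\alpha\Big)>0.$$ Then machine unlearning using gradient ascent with label smoothing of rate $\alpha$ on the forgetting set $D_f$ (whose prediction mechanism $\mathcal M$ on $D_f$ is described in the context) achieves $\epsilon$-Label-LDP on $D_f$ with $$\epsilon=\left|\log\left(\frac{K}{\alpha}\Big(1-\frac{\gamma_1}{\gamma_2}\Big)+1-K\right)\right|.$$
   Context: $\mathcal Y$ is a set of $K$ labels. $D_{tr}$ is a finite training set of examples $(x,y)$ with $y\in\mathcal Y$, and $D_f\subset D_{tr}$ is the forgetting set. $\ell(h_{\boldsymbol\theta},(x,y))$ is the cross-entropy loss, i.e. $-\log$ of the probability that the model $h_{\boldsymbol\theta}$ assigns to label $y$ on input $x$. Label smoothing with rate $\alpha$ replaces the loss of $(x,y)$ by $$\ell(h_{\boldsymbol\theta},z^{\mathrm{GLS},\alpha})=\Big(1+\tfrac{1-K}{K}\alpha\Big)\ell(h_{\boldsymbol\theta},(x,y))+\tfrac{\alpha}{K}\sum_{y'\in\mathcal Y\setminus\{y\}}\ell(h_{\boldsymbol\theta},(x,y')),$$ and it is called negative label smoothing when $\alpha<0$. Let $R_{tr}(\boldsymbol\theta)=\sum_{z\in D_{tr}}\ell(h_{\boldsymbol\theta},z)$ and $R_f^{\mathrm{NLS}}(\boldsymbol\theta;\alpha)=\sum_{z\in D_f}\ell(h_{\boldsymbol\theta},z^{\mathrm{GLS},\alpha})$.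 The model resulting from learning on $D_{tr}$ and then unlearning $D_f$ by gradient ascent with label smoothing is taken to be the minimizer of the risk $\gamma_1R_{tr}(\boldsymbol\theta)-\gamma_2R_f^{\mathrm{NLS}}(\boldsymbol\theta;\alpha)$, with $\gamma_1,\gamma_2>0$. Minimization is understood pointwise over predictive distributions. For an example in $D_f$ with input $x$ and label $y$, the random prediction $\mathcal M(y)\in\mathcal Y$ has the distribution $(\mathbb P(\mathcal M(y)=k))_{k\in\mathcal Y}=(p_k)_{k\in\mathcal Y}$ that minimizes, over the probability simplex on $\mathcal Y$, the contribution of that example to the risk: $$\gamma_1\,(-\log p_y)-\gamma_2\Big[\Big(1+\tfrac{1-K}{K}\alpha\Big)(-\log p_y)+\tfrac{\alpha}{K}\sum_{y'\ne y}(-\log p_{y'})\Big].$$ Label-LDP: a mechanism $\mathcal M$ satisfies $\epsilon$-Label-LDP if for all labels $y,y',y^{\mathrm{pred}}\in\mathcal Y$, $$\frac{\mathbb P(\mathcal M(y)=y^{\mathrm{pred}})}{\mathbb P(\mathcal M(y')=y^{\mathrm{pred}})}\le e^{\epsilon}.$$ *)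

(* Defs.v *)
From mathcomp Require Import all_boot all_order all_algebra.
From mathcomp Require Import all_classical all_reals all_analysis.

Set Implicit Arguments.
Unset Strict Implicit.
Unset Printing Implicit Defensive.

Import Order.TTheory GRing.Theory Num.Theory.

Local Open Scope classical_set_scope.
Local Open Scope ring_scope.

Definition simplex (R : realType) (Y : finType) : set (Y -> R) :=
  [set p | (forall k, 0 <= p k) /\ \sum_(k : Y) p k = 1].

(* [lne 0 = -oo], so the loss of a label of probability zero is [+oo]. *)
Definition cross_entropy (R : realType) (Y : finType) (p : Y -> R) (y : Y) :
    \bar R :=
  (- lne (p y)%:E)%E.

(* The operations of the scope [%dE] are those of [\bar R] except that
   [+oo - oo = +oo].  Hence, for [alpha < 0] and positive [gamma1] and
   [gamma2], [unlearning_risk] is [+oo] at every point of the boundary of the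
   simplex, where some of its terms are infinite (possibly of opposite signs),
   and is an ordinary real number in the interior.  With the addition of [%E],
   for which [+oo - oo = -oo], the points with [p y = 0] would be minimizers. *)
Definition gls_loss (R : realType) (Y : finType) (alpha : R) (p : Y -> R)
    (y : Y) : \bar R :=
  let K : R := #|Y|%:R in
  ((1 + (1 - K) / K * alpha)%:E * cross_entropy p y
   + (alpha / K)%:E * (\sum_(y' : Y | y' != y) cross_entropy p y')%E)%dE.

Definition unlearning_risk (R : realType) (Y : finType)
    (gamma1 gamma2 alpha : R) (y : Y) (p : Y -> R) : \bar R :=
  (gamma1%:E * cross_entropy p y - gamma2%:E * gls_loss alpha p y)%dE.

Definition minimizes_over (R : realType) (T : Type) (A : set T)
    (f : T -> \bar R) (p : T) : Prop :=
  A p /\ forall q, A q -> (f p <= f q)%E.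

(* A mechanism is given by its output laws: [M y k] is the probability that
   [M] outputs [k] when the true label is [y].  The ratio is taken in [\bar R],
   where [a / 0] is [+oo] for [0 < a]; the quotient of [R], for which
   [a / 0 = 0], would make the condition vacuous there. *)
Definition label_LDP (R : realType) (Y : finType) (eps : R)
    (M : Y -> Y -> R) : Prop :=
  forall y y' ypred : Y,
    ((M y ypred)%:E / (M y' ypred)%:E <= (expR eps)%:E)%E.

(* Main.v *)
(** On the interior of the simplex the risk of an example with label [y] is the
    cross entropy of the prediction relative to the weights
    [a = gamma1 - gamma2 (1 + (1 - K) / K alpha)] on [y] and
    [b = - gamma2 alpha / K] on each other label, both positive.  By the
    equality case of Gibbs' inequality its minimizer is the normalized weight,
    so any two predictions of a label differ by a factor among [1], [a / b] and
    [b / a]; and [a / b] is the argument of the logarithm in epsilon. *)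
Require Import Defs.
From mathcomp Require Import all_boot all_order all_algebra.
From mathcomp Require Import all_classical all_reals all_analysis.
From mathcomp Require Import ring lra.

Import Order.TTheory GRing.Theory Num.Theory.

Local Open Scope classical_set_scope.
Local Open Scope ring_scope.

Set Implicit Arguments.
Unset Strict Implicit.

Lemma ln_lt_subr1 (R : realType) (x : R) : 0 < x -> x != 1 -> ln x < x - 1.
Proof.
move=> x0 x1; have ln0 : ln x != 0 by rewrite ln_eq0.
by have := expR_gt1Dx ln0; rewrite lnK//; lra.
Qed.

(** The tangent-line bound [ln x < x - 1] at [x = p / q], scaled by [q]; its strictness yields the
    equality case of Gibbs' inequality. *)
Lemma mulr_ln_sub_lt (R : realType) (p q : R) :
  0 < p -> 0 < q -> p != q -> q * (ln p - ln q) < p - q.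
Proof.
move=> p0 q0 pq.
have q_neq0 : q != 0 by rewrite gt_eqF.
have pq1 : p / q != 1.
  by apply: contra_neq pq => pq1; rewrite -[LHS](divfK q_neq0) pq1 mul1r.
rewrite -ln_div//.
have := ln_lt_subr1 (divr_gt0 p0 q0) pq1; rewrite -(ltr_pM2l q0).
by congr (_ < _); field.
Qed.

(** Each gap [d i] is nonnegative and vanishes only if [p i = q i]. Equal masses and the assumed
    inequality make the gaps sum to at most 0, so all of them vanish. *)
Lemma gibbs_eq (R : realType) (I : finType) (p q : I -> R) :
  (forall i, 0 < p i) -> (forall i, 0 < q i) ->
  \sum_i p i = \sum_i q i ->
  \sum_i q i * ln (q i) <= \sum_i q i * ln (p i) ->
  p =1 q.
Proof.
move=> p0 q0 pq_sum pq_le.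
pose d i := (p i - q i) - q i * (ln (p i) - ln (q i)).
have d_ge0 i : 0 <= d i.
  rewrite subr_ge0; have [->|pq] := eqVneq (p i) (q i); first by rewrite !subrr mulr0.
  exact/ltW/mulr_ln_sub_lt.
have d_sum : \sum_i d i = 0.
  apply/eqP; rewrite eq_le sumr_ge0 ?andbT//.
  rewrite /d sumrB sumrB pq_sum subrr sub0r oppr_le0.
  under eq_bigr do rewrite mulrBr.
  by rewrite sumrB subr_ge0.
move=> i; apply/eqP/negPn/negP => pq.
have := psumr_eq0P (fun i _ => d_ge0 i) d_sum (i := i) isT.
by apply/eqP; rewrite gt_eqF// subr_gt0; exact: mulr_ln_sub_lt.
Qed.

Section unlearning.
Variables (R : realType) (Y : finType) (gamma1 gamma2 alpha : R).

Let K : R := #|Y|%:R.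

Definition true_weight : R := gamma1 - gamma2 * (1 + (1 - K) / K * alpha).

Definition other_weight : R := - (gamma2 * (alpha / K)).

Definition label_weight (y k : Y) : R :=
  if k == y then true_weight else other_weight.

(** This normalizing constant is the same for every true label, so it cancels when two predictions
    are compared. *)
Definition total_weight : R := true_weight + other_weight *+ #|Y|.-1.

Lemma sum_label_weight y : \sum_k label_weight y k = total_weight.
Proof.
rewrite (bigD1 y)//= /label_weight eqxx; congr (_ + _).
rewrite (eq_bigr (fun=> other_weight)); last by move=> k /negbTE ->.
by rewrite sumr_const cardC1.
Qed.

Lemma cross_entropy_gt0E (p : Y -> R) k :
  0 < p k -> cross_entropy p k = (- ln (p k))%:E.
Proof. by move=> pk0; rewrite /cross_entropy lne_EFin. Qed.

Lemma cross_entropy_eq0E (p : Y -> R) k : p k = 0 -> cross_entropy p k = +oo%E.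
Proof. by move=> pk0; rewrite /cross_entropy le0_lneNy// pk0. Qed.

Lemma unlearning_risk_interior (p : Y -> R) y : (forall k, 0 < p k) ->
  unlearning_risk gamma1 gamma2 alpha y p =
  (- \sum_k label_weight y k * ln (p k))%:E.
Proof.
move=> p0; rewrite /unlearning_risk /gls_loss cross_entropy_gt0E//.
under eq_bigr do rewrite cross_entropy_gt0E//.
(* All cross entropies are now finite, so the dual operations on [\bar R] compute to those of [R]
   and the risk is convertible to a real number. *)
rewrite sumEFin sumrN -[LHS]/((gamma1 * - ln (p y) -
  gamma2 * ((1 + (1 - K) / K * alpha) * - ln (p y) +
            alpha / K * - \sum_(k | k != y) ln (p k)))%:E) [in RHS](bigD1 y)//=.
rewrite [in RHS](eq_bigr (fun k => other_weight * ln (p k))); last first.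
  by move=> k /negbTE ky; rewrite /label_weight ky.
rewrite -mulr_sumr /label_weight eqxx /true_weight /other_weight -/K.
by congr (_%:E); ring.
Qed.

Hypotheses (gamma1_gt0 : 0 < gamma1) (gamma2_gt0 : 0 < gamma2).
Hypotheses (alpha_lt0 : alpha < 0).

(** If [p y = 0], the [gamma1] term is [+oo] and absorbs the rest under dual addition. Otherwise
    [k != y], the sum over the other labels is [+oo], and the two negative factors [alpha / K] and
    [- gamma2] return it to [+oo]. *)
Lemma unlearning_risk_boundary (p : Y -> R) y k : (forall k, 0 <= p k) ->
  p k = 0 -> unlearning_risk gamma1 gamma2 alpha y p = +oo%E.
Proof.
move=> p0 pk0; rewrite /unlearning_risk /gls_loss.
have [py0|py0] := eqVneq (p y) 0.
  by rewrite (cross_entropy_eq0E py0) gt0_muley ?lte_fin//.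
have Y0 : 0 < K by rewrite ltr0n; apply/card_gt0P; exists y.
have ky : k != y by apply: contra_neq py0 => <-.
have sum_oo : (\sum_(y' | y' != y) cross_entropy p y')%E = +oo%E.
  apply/eqP; rewrite esum_eqy.
    by apply/existsP; exists k; rewrite unfold_in/= ky cross_entropy_eq0E.
  move=> i _; have := p0 i; rewrite le_eqVlt => /orP[/eqP/esym pi0|pi0].
    by rewrite cross_entropy_eq0E.
  by rewrite cross_entropy_gt0E.
rewrite sum_oo cross_entropy_gt0E ?lt_def ?py0 ?p0//.
rewrite lt0_muley ?lte_fin; last by rewrite pmulr_llt0 ?invr_gt0.
by rewrite -!EFinM /= gt0_muleNy.
Qed.

Hypothesis true_weight_gt0 : 0 < true_weight.

(** The label [y] witnesses [0 < K]; for [K = 0] the convention [alpha / 0 = 0] would give weight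
    0. *)
Lemma other_weight_gt0 (y : Y) : 0 < other_weight.
Proof.
have Y0 : 0 < K by rewrite ltr0n; apply/card_gt0P; exists y.
by rewrite oppr_gt0 pmulr_rlt0// pmulr_llt0 ?invr_gt0.
Qed.

Lemma label_weight_gt0 (y k : Y) : 0 < label_weight y k.
Proof. by rewrite /label_weight; case: ifP => // _; exact: other_weight_gt0 y. Qed.

Lemma total_weight_gt0 (y : Y) : 0 < total_weight.
Proof. by rewrite ltr_pwDl// mulrn_wge0// ltW// (other_weight_gt0 y). Qed.

Lemma unlearning_minimizerE (y : Y) (p : Y -> R) :
  minimizes_over (@simplex R Y) (unlearning_risk gamma1 gamma2 alpha y) p ->
  forall k, p k = label_weight y k / total_weight.
Proof.
move=> [[p_ge0 p_sum] p_min].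
pose q k := label_weight y k / total_weight.
have W0 := total_weight_gt0 y.
have q0 k : 0 < q k by rewrite divr_gt0// label_weight_gt0.
have q_sum : \sum_k q k = 1.
  by rewrite -mulr_suml sum_label_weight divff// gt_eqF.
have := p_min q (conj (fun k => ltW (q0 k)) q_sum).
rewrite (unlearning_risk_interior _ q0) => p_le.
(* The risk at the interior competitor [q] is finite, so a minimizer cannot lie on the boundary,
   where the risk is [+oo]. *)
have p0 k : 0 < p k.
  rewrite lt_def p_ge0 andbT; apply/negP => /eqP pk0.
  by move: p_le; rewrite (unlearning_risk_boundary _ p_ge0 pk0).
move: p_le; rewrite unlearning_risk_interior// lee_fin lerN2 => p_le.
apply: gibbs_eq => //; first by rewrite p_sum q_sum.
(* Scaling by the total weight turns the coefficients [q k] into the label weights of [p_le]. *)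
rewrite -(ler_pM2l W0) !mulr_sumr.
have qE k c : total_weight * (q k * c) = label_weight y k * c.
  by rewrite /q; field; rewrite gt_eqF.
by under eq_bigr do rewrite qE; under [leRHS]eq_bigr do rewrite qE.
Qed.

End unlearning.

(** The absolute value dominates both [ln r] and [ln r^-1 = - ln r], so one epsilon serves both
    orders of the two labels. *)
Lemma ratio_le_expR_norm_ln (R : realType) (r : R) : 0 < r ->
  (r <= expR `|ln r|) && (r^-1 <= expR `|ln r|).
Proof.
move=> r0; apply/andP; split; first by rewrite -[leLHS]lnK// ler_expR ler_norm.
by rewrite -[leLHS]lnK ?posrE ?invr_gt0// ler_expR lnV// -normrN ler_norm.
Qed.

Lemma weight_ratioE (R : realType) (Y : finType) (gamma1 gamma2 alpha : R) :
  (0 < #|Y|)%N -> alpha != 0 -> gamma2 != 0 ->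
  true_weight Y gamma1 gamma2 alpha / other_weight Y gamma2 alpha =
  #|Y|%:R / alpha * (1 - gamma1 / gamma2) + 1 - #|Y|%:R.
Proof.
move=> Y0 alpha0 gamma20; rewrite /true_weight /other_weight.
have K0 : #|Y|%:R != 0 :> R by rewrite pnatr_eq0 -lt0n.
by field; rewrite K0 alpha0 gamma20.
Qed.

Unset Implicit Arguments.

(* [M x y] is the law of the prediction on the forgotten example with input
   [x] when the label of that example is [y]. *)
Theorem theorem3 (R : realType) (X : Type) (Y : finType) (K : nat)
    (D_tr D_f : set (X * Y)) (alpha gamma1 gamma2 : R)
    (M : X -> Y -> Y -> R)
    (cardY : #|Y| = K) (K_ge2 : (2 <= K)%N)
    (D_tr_fin : finite_set D_tr) (D_f_sub : D_f `<=` D_tr)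
    (alpha_lt0 : alpha < 0) (gamma1_gt0 : 0 < gamma1) (gamma2_gt0 : 0 < gamma2)
    (weight_gt0 :
      0 < gamma1 - gamma2 * (1 + (1 - K%:R) / K%:R * alpha))
    (M_unlearn : forall (x : X) (y0 : Y), D_f (x, y0) ->
      forall y : Y,
        minimizes_over (@simplex R Y) (unlearning_risk gamma1 gamma2 alpha y)
          (M x y)) :
  forall (x : X) (y0 : Y), D_f (x, y0) ->
    label_LDP `|ln (K%:R / alpha * (1 - gamma1 / gamma2) + 1 - K%:R)| (M x).
Proof.
move=> x y0 Dxy0 y y' k; subst K.
rewrite -weight_ratioE ?(ltnW K_ge2) ?(lt_eqF alpha_lt0)
  ?(gt_eqF gamma2_gt0)//.
have a0 : 0 < true_weight Y gamma1 gamma2 alpha by [].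
have b0 := other_weight_gt0 gamma2_gt0 alpha_lt0 y.
have W0 := total_weight_gt0 gamma2_gt0 alpha_lt0 a0 y.
have w0 := label_weight_gt0 gamma2_gt0 alpha_lt0 a0.
have ME z := unlearning_minimizerE gamma1_gt0 gamma2_gt0 alpha_lt0
  a0 (M_unlearn _ _ Dxy0 z) k.
(* The denominator is positive, so the quotient in [\bar R] is the real one, and the total weight
   then cancels. *)
rewrite !ME inver gt_eqF ?divr_gt0// -EFinM lee_fin.
rewrite invf_div mulrA divfK ?gt_eqF//.
have [ab ba] := andP (ratio_le_expR_norm_ln (divr_gt0 a0 b0)).
rewrite invf_div in ba.
(* If [k] equals exactly one of [y] and [y'], the ratio is [a / b] or [b / a], bounded by [ab] or
   [ba]. In the remaining cases it is 1, and the exponent is nonnegative. *)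
rewrite /label_weight; case: ifP => _; case: ifP => _ //.
all: by rewrite divff ?gt_eqF// -expR0 ler_expR.
Qed.
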